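(* Let $D=\operatorname{diag}(\lambda_1,\dots,\lambda_n)$ with $\lambda_1>\dots>\lambda_n$, let $\pi\in S_n$, and let $p$ be a real polynomial. The set $\mathcal U^{\mathbf{GL}}_{D^\pi}$ is invariant under the Toda flow $\dot M=[M,\Pi_{\mathfrak o}\,p(M)]$. In the linearizing variables $(D^\pi,Y,Z)$ the flow is $$\dot D^\pi=0,\qquad \dot Y=0,\qquad \dot Z=[Z,-p(D^\pi)].$$ In particular, the solution $M(t)$ is globally defined: if $M(0)\in\mathcal U^{\mathbf{GL}}_{D^\pi}$, then $M(t)\in\mathcal U^{\mathbf{GL}}_{D^\pi}$ for all $t\in\mathbb R$.
   Context: All matrices are real $n\times n$; $\mathcal M$ is the space of all of them and $[A,B]=AB-BA$. $P_\pi$ is the permutation matrix with $P_\pi e_i=e_{\pi(i)}$, and $D^\pi=P_\pi^\top DP_\pi=\operatorname{diag}(\lambda_{\pi(1)},\dots,\lambda_{\pi(n)})$. $\mathbf{GL}^{\mathrm{pos}}$ and $\mathbf O^{\mathrm{pos}}$ are the sets of invertible, respectively orthogonal, matrices all of whose leading principal minors (determinants of the top left $k\times k$ blocks, $k=1,\dots,n$) are positive. $\mathbf{Lo}^1$ is the group of lower triangular matrices with unit diagonal, $\mathfrak{lo}^0$ the strictly lower triangular matrices, $\mathbf{Up}^+$ the upper triangular matrices with positive diagonal. $\mathcal U^{\mathbf{GL}}_{D^\pi}=\{X^{-1}D^\pi X : X\in\mathbf{GL}^{\mathrm{pos}}\}$. Linearizing variables: each $M\in\mathcal U^{\mathbf{GL}}_{D^\pi}$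 can be written uniquely as $M=Q^\top(Y+D^\pi)Q$ with $Q\in\mathbf O^{\mathrm{pos}}$, $Y\in\mathfrak{lo}^0$; writing uniquely $Q=LU$ with $L\in\mathbf{Lo}^1$, $U\in\mathbf{Up}^+$, one defines $Z\in\mathfrak{lo}^0$ by $Z+D^\pi=L^{-1}(Y+D^\pi)L$, so that $M=U^{-1}(Z+D^\pi)U$. The linearizing variables of $M$ are $(D^\pi,Y,Z)$. $\Pi_{\mathfrak o}:\mathcal M\to\mathfrak o$ is the projection associated with the direct sum $\mathcal M=\mathfrak o\oplus\mathfrak{up}$ of skew-symmetric and upper triangular matrices. *)

(* Defs.v *)
From HB Require Import structures.
From mathcomp Require Import all_boot all_order all_algebra all_fingroup.
From mathcomp Require Import all_classical all_reals all_analysis.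
Set Implicit Arguments.
Unset Strict Implicit.
Unset Printing Implicit Defensive.
Import Order.TTheory GRing.Theory Num.Theory.
Import numFieldNormedType.Exports.
Local Open Scope classical_set_scope.
Local Open Scope ring_scope.

Section MatrixSets.
Variables (R : realType) (n : nat).
Implicit Types (A B L M Q U X Y Z K : 'M[R]_n.+1).

Definition lie_bracket A B := A *m B - B *m A.

Definition leading_minor X (k : 'I_n.+1) : R :=
  \det (mxsub (widen_ord (ltn_ord k)) (widen_ord (ltn_ord k)) X).

Definition GLpos : set 'M[R]_n.+1 :=
  [set X | X \in unitmx /\ forall k, 0 < leading_minor X k].

Definition Opos : set 'M[R]_n.+1 :=
  [set Q | Q^T *m Q = 1%:M /\ forall k, 0 < leading_minor Q k].

Definition Lo1 : set 'M[R]_n.+1 :=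
  [set L | is_trig_mx L /\ forall i, L i i = 1].

Definition lo0 : set 'M[R]_n.+1 :=
  [set Y | forall i j : 'I_n.+1, (i <= j)%N -> Y i j = 0].

Definition upper : set 'M[R]_n.+1 := [set U | is_trig_mx U^T].

Definition Uppos : set 'M[R]_n.+1 :=
  [set U | upper U /\ forall i, 0 < U i i].

Definition skew : set 'M[R]_n.+1 := [set K | K^T = - K].

Definition strict_lower A : 'M[R]_n.+1 :=
  \matrix_(i, j) (if (j < i)%N then A i j else 0).

Definition proj_skew A := strict_lower A - (strict_lower A)^T.

(* proj_skew is the projection onto the first summand of skew (+) upper. *)
Lemma proj_skewP A K : K = proj_skew A <-> skew K /\ upper (A - K).
Proof.
split=> [->|[sK /is_trig_mxP uK]].
  split; first by rewrite /skew /= /proj_skew linearB /= trmxK opprB.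
  apply/is_trig_mxP => i j ij; rewrite !mxE ij ltnNge (ltnW ij) /=.
  by rewrite subr0 subrr.
have low (i j : 'I_n.+1) : (j < i)%N -> K i j = A i j.
  by move=> /uK /eqP; rewrite !mxE subr_eq0 => /eqP.
have sk (i j : 'I_n.+1) : K j i = - K i j.
  by move/matrixP: sK => /(_ i j); rewrite !mxE.
apply/matrixP => i j; rewrite !mxE.
case: (ltngtP i j) => ij.
- by rewrite sub0r sk low.
- by rewrite subr0 low.
- have/eqP := sk i j; rewrite (ord_inj ij) -addr_eq0 -mulr2n mulrn_eq0 /=.
  by move=> /eqP ->; rewrite subrr.
Qed.

Definition strictly_decreasing (lam : 'I_n.+1 -> R) :=
  forall i j : 'I_n.+1, (i < j)%N -> lam j < lam i.

(* P_s e_i = e_(s i) on column vectors; this is the transpose of the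
   library's perm_mx s. *)
Definition perm_mat (s : 'S_n.+1) : 'M[R]_n.+1 :=
  \matrix_(i, j) (i == s j)%:R.

Definition perm_diag (lam : 'I_n.+1 -> R) (s : 'S_n.+1) : 'M[R]_n.+1 :=
  (perm_mat s)^T *m diag_mx (\row_i lam i) *m perm_mat s.

Lemma perm_diagE lam s : perm_diag lam s = diag_mx (\row_i lam (s i)).
Proof.
have Ps : perm_mat s = (perm_mx s)^T.
  by apply/matrixP => i j; rewrite !mxE eq_sym.
rewrite /perm_diag Ps trmxK -row_permE tr_perm_mx -[s in LHS]invgK.
rewrite invgK -col_permE; apply/matrixP => i j; rewrite !mxE.
by rewrite (inj_eq perm_inj).
Qed.

Definition UGL (E : 'M[R]_n.+1) : set 'M[R]_n.+1 :=
  [set M | exists2 X, GLpos X & M = invmx X *m E *m X].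

(* v = (D^s, Y, Z) are the linearizing variables of M in the chart of s. The
   decreasing spectrum is not prescribed but read off from M, so that D^s is a
   genuine function of M. *)
Definition linearizing_variables (s : 'S_n.+1) M
    (v : 'M[R]_n.+1 * 'M[R]_n.+1 * 'M[R]_n.+1) : Prop :=
  let: (E, Y, Z) := v in
  [/\ exists2 lam, strictly_decreasing lam & E = perm_diag lam s,
      UGL E M,
      lo0 Y,
      lo0 Z &
      exists Q L U, [/\ Opos Q, Lo1 L, Uppos U, Q = L *m U &
        M = Q^T *m (Y + E) *m Q /\ Z + E = invmx L *m (Y + E) *m L]].

Definition open_interval (I : set R) := open I /\ is_interval I.

Definition toda_solution (p : {poly R}) (I : set R) (M : R -> 'M[R]_n.+1) :=
  forall t, I t ->
    is_derive t 1 M (lie_bracket (M t) (proj_skew (horner_mx (M t) p))).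

End MatrixSets.

(* Main.v *)
Require Import Defs.
From HB Require Import structures.
From mathcomp Require Import all_boot all_order all_algebra all_fingroup.
From mathcomp Require Import all_classical all_reals all_analysis.
From mathcomp Require Import ring.
Set Implicit Arguments.
Unset Strict Implicit.
Unset Printing Implicit Defensive.
Import Order.TTheory GRing.Theory Num.Theory.
Import numFieldNormedType.Exports.
Local Open Scope classical_set_scope.
Local Open Scope ring_scope.

(** Write the initial matrix as M0 = X^-1 E X, so that exp(t p(M0)) =
    X^-1 diag(exp(t p(E_i))) X, and let Q(t) R(t) be the QR factorization of
    this curve. Then M(t) = Q^T M0 Q = R M0 R^-1 solves the Toda flow: Q^T Q'
    is skew while p(M) - Q^T Q' = R' R^-1 is upper triangular, so Q^T Q' is the
    skew projection of p(M). As R has positive diagonal, M(t) = (X R^-1)^-1 E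
    (X R^-1) stays in the chart. Orthogonal conjugation keeps Y, and Z evolves
    as exp(t p(E)) Z exp(-t p(E)). Solutions are unique by Gronwall's
    inequality, and differentiability of Q and R comes from a recursive LU
    factorization of the Gram matrix. Linearizing variables are unique because
    Q = G X with G lower triangular of positive diagonal: two such orthogonal Q
    differ by an orthogonal lower triangular matrix of positive diagonal, that
    is, by the identity. *)

(** * Triangular matrices and the LU factorization *)

Section Inverse.
Variables (F : fieldType) (n : nat).
Implicit Types A B : 'M[F]_n.

Lemma invmx_mul A B : A \in unitmx -> B \in unitmx ->
  invmx (A *m B) = invmx B *m invmx A.
Proof.
move=> uA uB; have uAB : A *m B \in unitmx by rewrite unitmx_mul uA.
rewrite -[RHS](mulmxK uAB) !mulmxA -(mulmxA _ _ A) mulVmx // mulmx1.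
by rewrite mulVmx // mul1mx.
Qed.

Lemma orth_trmxE A : A^T *m A = 1%:M -> A^T = invmx A.
Proof.
by move=> o; have [_ uA] := mulmx1_unit o; rewrite -[LHS](mulmxK uA) o mul1mx.
Qed.

End Inverse.

Section Triangular.
Variables (F : fieldType) (n : nat).
Implicit Types A B C : 'M[F]_n.

Lemma trig_mulmx A B : is_trig_mx A -> is_trig_mx B -> is_trig_mx (A *m B).
Proof.
move=> /is_trig_mxP tA /is_trig_mxP tB; apply/is_trig_mxP => i j ij.
rewrite mxE big1 // => k _; have [ik|ki] := ltnP i k.
  by rewrite tA ?mul0r.
by rewrite tB ?mulr0 // (leq_ltn_trans ki).
Qed.

Lemma trig_mulmx_diag A B i :
  is_trig_mx A -> is_trig_mx B -> (A *m B) i i = A i i * B i i.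
Proof.
move=> /is_trig_mxP tA /is_trig_mxP tB.
rewrite mxE (bigD1 i) //= big1 ?addr0 // => k; rewrite neq_ltn => /orP[ki|ik].
  by rewrite tB ?mulr0.
by rewrite tA ?mul0r.
Qed.

(* For e = 0 this says that left division by A preserves lower triangularity;
   for A C = C diag(e) it says that the eigenvectors of A are triangular. *)
Lemma trig_sylvester A C (e : 'I_n -> F) : is_trig_mx A ->
  (forall i j : 'I_n, (i < j)%N -> A i i != e j) ->
  (forall i j : 'I_n, (i < j)%N -> (A *m C) i j = C i j * e j) ->
  is_trig_mx C.
Proof.
move=> /is_trig_mxP tA Ae AC; apply/is_trig_mxP => i j.
(* Induction on the row [i]. In the sum for [(A *m C) i j], the terms [k > i] vanish because [A] is
   triangular and the terms [k < i] by induction, so only [A i i * C i j] is left. *)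
have [m] := ubnP (i : nat); elim: m i => // m IH i; rewrite ltnS => im ij.
have := AC _ _ ij; rewrite mxE (bigD1 i) //= big1 ?addr0.
  move/eqP; rewrite [C i j * _]mulrC -subr_eq0 -mulrBl mulf_eq0 subr_eq0.
  by rewrite (negPf (Ae _ _ ij)) => /eqP.
move=> k; rewrite neq_ltn => /orP[ki|ik]; last by rewrite tA ?mul0r.
by rewrite (IH k) ?mulr0 //; [apply: leq_trans ki _|apply: ltn_trans ki _].
Qed.

Lemma trig_unitmx A :
  is_trig_mx A -> (A \in unitmx) = [forall i, A i i != 0].
Proof.
move=> tA; rewrite unitmxE unitfE det_trig //.
by apply/prodf_neq0/forallP => [nz i|nz i _]; apply: nz.
Qed.

Lemma trig_invmx A : is_trig_mx A -> is_trig_mx (invmx A).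
Proof.
(* By convention [invmx] returns a singular matrix unchanged, which settles that case. *)
move=> tA; have [uA|uA] := boolP (A \in unitmx); last first.
  by rewrite /invmx (negPf uA).
apply: (@trig_sylvester A _ (fun=> 0)) => // [i j _|i j ij].
  by move: uA; rewrite trig_unitmx // => /forallP.
by rewrite mulmxV // mulr0 mxE -val_eqE ltn_eqF.
Qed.

Lemma trig_invmx_diag A i :
  is_trig_mx A -> A \in unitmx -> (invmx A) i i = (A i i)^-1.
Proof.
move=> tA uA; have := trig_mulmx_diag i tA (trig_invmx tA).
rewrite mulmxV // mxE eqxx => /esym e1.
have nz : A i i != 0 by move: uA; rewrite trig_unitmx // => /forallP.
by apply: (mulfI nz); rewrite e1 mulfV.
Qed.

(** The condition of [Lo1], but over any field and in every size, including 0, as the recursion of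
    the LU factorization requires. *)
Definition unitrig A := is_trig_mx A /\ forall i, A i i = 1.

Lemma unitrig_unitmx A : unitrig A -> A \in unitmx.
Proof.
case=> tA A1; rewrite trig_unitmx //.
by apply/forallP => i; rewrite A1 oner_eq0.
Qed.

Lemma unitrig_upper_eq1 A : unitrig A -> is_trig_mx A^T -> A = 1%:M.
Proof.
case=> /is_trig_mxP tA A1 /is_trig_mxP tAT; apply/matrixP => i j.
rewrite mxE; case: eqVneq => [<-|]; first exact: A1.
rewrite -val_eqE neq_ltn => /orP[/tA //|ji].
by have := tAT _ _ ji; rewrite mxE.
Qed.

(** The matrix [L'^-1 L = U' U^-1] is both unit lower triangular and upper triangular, hence the
    identity. *)
Lemma LU_unique (L U L' U' : 'M[F]_n) : unitrig L -> unitrig L' ->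
  is_trig_mx U^T -> is_trig_mx U'^T -> U \in unitmx ->
  L *m U = L' *m U' -> L = L' /\ U = U'.
Proof.
move=> uL uL' tU tU' uU LU.
have uiL' := unitrig_unitmx uL'.
have e : invmx L' *m L = U' *m invmx U.
  by rewrite -(mulmxK uU L) LU !mulmxA mulVmx // mul1mx.
have e1 : invmx L' *m L = 1%:M.
  apply: unitrig_upper_eq1.
    split=> [|i].
      by apply: trig_mulmx; [apply: trig_invmx uL'.1|case: uL].
    rewrite trig_mulmx_diag ?trig_invmx ?uL.1 ?uL'.1 //.
    by rewrite trig_invmx_diag ?uL'.1 // uL.2 uL'.2 invr1 mulr1.
  by rewrite e trmx_mul trmx_inv trig_mulmx ?trig_invmx.
have eL : L = L' by rewrite -[LHS](mulKVmx uiL') e1 mulmx1.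
by split=> //; move: LU; rewrite eL => /(can_inj (mulKmx uiL')).
Qed.

End Triangular.

Section LeadingBlock.
Variables (F : fieldType) (n : nat).
Implicit Types A X : 'M[F]_n.

(** [leading_minor X k] is the determinant of the block of size [k.+1]; here [k] is the size itself,
    and the empty block is allowed. *)
Definition lead k (kn : (k <= n)%N) X : 'M[F]_k :=
  mxsub (widen_ord kn) (widen_ord kn) X.

Lemma lead_trig k (kn : (k <= n)%N) A : is_trig_mx A -> is_trig_mx (lead kn A).
Proof.
by move=> /is_trig_mxP tA; apply/is_trig_mxP => i j ij; rewrite mxE tA.
Qed.

(** The first [k] rows of a lower triangular [A] are supported on the first [k] columns, so the
    later rows of [X] do not contribute. *)
Lemma lead_mul_trig k (kn : (k <= n)%N) A X :
  is_trig_mx A -> lead kn (A *m X) = lead kn A *m lead kn X.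
Proof.
move=> /is_trig_mxP tA; apply/matrixP => i j; rewrite !mxE.
rewrite (bigID (fun l : 'I_n => (l < k)%N)) /= addrC big1 ?add0r => [|l];
  last first.
  by rewrite -leqNgt => kl; rewrite tA ?mul0r //= (leq_trans (ltn_ord i)).
by rewrite (big_ord_narrow kn); apply: eq_bigr => l _; rewrite !mxE.
Qed.

Lemma det_lead_mul_trig k (kn : (k <= n)%N) A X : is_trig_mx A ->
  \det (lead kn (A *m X)) =
  (\prod_(i < k) A (widen_ord kn i) (widen_ord kn i)) * \det (lead kn X).
Proof.
move=> tA; rewrite lead_mul_trig // det_mulmx det_trig ?lead_trig //.
by congr (_ * _); apply: eq_bigr => i _; rewrite mxE.
Qed.

Lemma lead_tr k (kn : (k <= n)%N) X : lead kn X^T = (lead kn X)^T.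
Proof. by rewrite /lead trmx_mxsub. Qed.

Definition regular_minors X :=
  forall k (kn : (k <= n)%N), \det (lead kn X) != 0.

End LeadingBlock.

(** * Gaussian elimination by Schur complements *)

Section LU.
Variable F : fieldType.

Definition schur n (A : 'M[F]_(1 + n)) : 'M[F]_n :=
  drsubmx A - (A 0 0)^-1 *: (dlsubmx A *m ursubmx A).

(* Elimination without pivoting: meaningful only when the leading minors are
   nonzero (otherwise the pivot A 0 0 may be 0, whose inverse is 0). *)
Fixpoint luL n : 'M[F]_n -> 'M[F]_n :=
  match n with
  | 0 => id
  | n'.+1 => fun A : 'M[F]_(1 + n') =>
      block_mx 1%:M 0 ((A 0 0)^-1 *: dlsubmx A) (luL (schur A)) : 'M[F]_(1 + n')
  end.

Fixpoint luU n : 'M[F]_n -> 'M[F]_n :=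
  match n with
  | 0 => id
  | n'.+1 => fun A : 'M[F]_(1 + n') =>
      block_mx (ulsubmx A) (ursubmx A) 0 (luU (schur A)) : 'M[F]_(1 + n')
  end.

Lemma luL_unitrig n (A : 'M[F]_n) : unitrig (luL A).
Proof.
elim: n A => [|n IH] A; first by split; [apply/is_trig_mxP => -[]|case].
have [tL L1] := IH (schur A); split.
  by rewrite /= (@is_trig_block_mx _ 1 n 1 n) // eqxx scalar_mx_is_trig tL.
move=> i /=; case: (@split_ordP 1 n i) => j ->.
  by rewrite (@block_mxEul _ 1 n 1 n) mxE ord1 eqxx.
by rewrite (@block_mxEdr _ 1 n 1 n) L1.
Qed.

Lemma luU_upper n (A : 'M[F]_n) : is_trig_mx (luU A)^T.
Proof.
elim: n A => [|n IH] A; first by apply/is_trig_mxP => -[].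
rewrite /= (@tr_block_mx _ 1 n 1 n) (@is_trig_block_mx _ 1 n 1 n) //.
by rewrite trmx0 eqxx mx11_is_trig IH.
Qed.

Lemma schur_elim n (A : 'M[F]_(1 + n)) : A 0 0 != 0 ->
  block_mx 1%:M 0 ((A 0 0)^-1 *: dlsubmx A) 1%:M
    *m block_mx (ulsubmx A) (ursubmx A) 0 (schur A) = A.
Proof.
move=> a0; have ul : ulsubmx A = (A 0 0)%:M.
  rewrite [LHS]mx11_scalar !mxE; congr (A _ _)%:M; exact/val_inj.
rewrite mulmx_block !mul1mx !mul0mx ?mulmx0 !addr0 -[RHS]submxK.
congr (block_mx _ _ _ _).
  by rewrite ul mul_mx_scalar scalerA mulfV // scale1r.
by rewrite /schur -scalemxAl addrC subrK.
Qed.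

Lemma regular_minors00 n (A : 'M[F]_(1 + n)) : regular_minors A -> A 0 0 != 0.
Proof.
move=> /(_ 1%N isT); rewrite det_mx11 mxE; congr (A _ _ != 0); exact/val_inj.
Qed.

(** The left factor in [schur_elim] is unit lower triangular, so the minor of size [1 + k] of [A]
    equals the pivot times the minor of size [k] of the Schur complement. *)
Lemma regular_minors_schur n (A : 'M[F]_(1 + n)) :
  regular_minors A -> regular_minors (schur A).
Proof.
move=> rA k kn; have a0 := regular_minors00 rA.
have kn' : (1 + k <= 1 + n)%N by [].
have := rA _ kn'; rewrite -{1}(schur_elim a0) det_lead_mul_trig; last first.
  by rewrite is_trig_block_mx // eqxx !scalar_mx_is_trig.
rewrite mulf_eq0 negb_or => /andP[_].
suff -> : lead kn' (block_mx (ulsubmx A) (ursubmx A) 0 (schur A)) =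
    block_mx (ulsubmx A) (colsub (widen_ord kn) (ursubmx A))
      0 (lead kn (schur A)).
  by rewrite det_ublock mulf_eq0 negb_or => /andP[].
have wl (i : 'I_1) : widen_ord kn' (lshift k i) = lshift n i by apply/val_inj.
have wr (i : 'I_k) : widen_ord kn' (rshift 1 i) = rshift 1 (widen_ord kn i).
  exact/val_inj.
rewrite -[LHS](@submxK _ 1 k 1 k); congr (block_mx _ _ _ _);
  apply/matrixP => i j; rewrite [LHS]mxE [LHS]mxE [LHS]mxE ?wl ?wr.
- by rewrite block_mxEul.
- by rewrite block_mxEur [RHS]mxE.
- by rewrite block_mxEdl !mxE.
- by rewrite block_mxEdr [RHS]mxE.
Qed.

Lemma lu_mul n (A : 'M[F]_n) : regular_minors A -> luL A *m luU A = A.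
Proof.
elim: n A => [|n IH] A rA; first by apply/matrixP => -[].
rewrite -[RHS](schur_elim (regular_minors00 rA)) /=.
rewrite !(@mulmx_block _ 1 n 1 n 1 n) ?mul1mx !mul0mx !mulmx0 !addr0 ?add0r.
by rewrite IH //; apply: regular_minors_schur.
Qed.

Lemma luU_diag_neq0 n (A : 'M[F]_n) i : regular_minors A -> luU A i i != 0.
Proof.
move=> rA; have := rA n (leqnn n); have -> : lead (leqnn n) A = A.
  by apply/matrixP => k l; rewrite mxE; congr (A _ _); apply/val_inj.
rewrite -{1}(lu_mul rA) det_mulmx -[\det (luU A)]det_tr.
rewrite (det_trig (luU_upper A)).
by rewrite mulf_eq0 negb_or => /andP[_ /prodf_neq0/(_ i isT)]; rewrite mxE.
Qed.

End LU.

(** * Cholesky and QR factorizations of an invertible matrix *)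

Section Cholesky.
Variables (R : rcfType) (n : nat).
Implicit Types X S : 'M[R]_n.

Lemma mulmx_tr_eq0 m k (v : 'M[R]_(m, k)) : v *m v^T = 0 -> v = 0.
Proof.
move=> v0; apply/matrixP => i j; rewrite mxE.
have /matrixP/(_ i i) := v0; rewrite !mxE => /psumr_eq0P s0.
have /eqP : v i j * v^T j i = 0.
  by apply: s0 => // l _; rewrite mxE -expr2 sqr_ge0.
by rewrite mxE mulf_eq0 orbb => /eqP.
Qed.

(** A leading block of [X^T *m X] is the Gram matrix of the first [k] columns of [X]. A row vector
    in its kernel gives a combination of these columns of norm zero, and the columns are
    independent. *)
Lemma gram_regular X : X \in unitmx -> regular_minors (X^T *m X).
Proof.
move=> uX k kn; apply/det0P => -[v v0 /(congr1 (mulmx^~ v^T))].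
have -> : lead kn (X^T *m X) =
    (colsub (widen_ord kn) X)^T *m (colsub (widen_ord kn) X)^T^T.
  by apply/matrixP => i j; rewrite !mxE; apply: eq_bigr => l _; rewrite !mxE.
rewrite mul0mx mulmxA -mulmxA -trmx_mul => /mulmx_tr_eq0.
have -> : (colsub (widen_ord kn) X)^T = rowsub (widen_ord kn) 1%:M *m X^T.
  by rewrite mul_rowsub_mx mul1mx trmx_mxsub.
rewrite mulmxA => /(congr1 (mulmx^~ (invmx X^T))).
rewrite mul0mx mulmxK ?unitmx_tr //.
move=> w0; move/eqP: v0; apply; apply/rowP => j; rewrite mxE.
have /rowP/(_ (widen_ord kn j)) := w0; rewrite !mxE (bigD1 j) //= big1.
  by rewrite !mxE eqxx mulr1 addr0.
by move=> i ij; rewrite !mxE -val_eqE /= val_eqE (negPf ij) mulr0.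
Qed.

(** With [Y = L^-1 X^T], the matrix [Y Y^T = U L^-T] is symmetric and upper triangular, hence
    diagonal, with the diagonal of [U]. Its diagonal entries are sums of squares, and they are
    nonzero because the minors are. *)
Lemma gram_luE X : X \in unitmx -> let S := X^T *m X in
  S = luL S *m diag_mx (\row_i luU S i i) *m (luL S)^T
  /\ forall i, 0 < luU S i i.
Proof.
move=> uX S; have rS := gram_regular uX.
have [tL L1] := luL_unitrig S; have uL := unitrig_unitmx (luL_unitrig S).
pose Y := invmx (luL S) *m X^T.
have YU : Y *m Y^T = luU S *m invmx (luL S)^T.
  rewrite trmx_mul trmxK trmx_inv mulmxA -(mulmxA _ X^T); congr (_ *m _).
  by rewrite -[RHS](mulKmx uL) lu_mul.
have tYU : is_trig_mx (Y *m Y^T)^T.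
  by rewrite YU trmx_mul trmx_inv trmxK trig_mulmx ?trig_invmx ?luU_upper.
have YUE i : (Y *m Y^T) i i = luU S i i.
  transitivity ((Y *m Y^T)^T i i); first by rewrite [RHS]mxE.
  rewrite YU trmx_mul trmx_inv trmxK trig_mulmx_diag ?trig_invmx ?luU_upper //.
  by rewrite trig_invmx_diag // L1 invr1 mul1r mxE.
have dY : Y *m Y^T = diag_mx (\row_i luU S i i).
  apply/matrixP => i j; rewrite [RHS]mxE [(\row__ _) _ _]mxE -YUE.
  case: eqVneq => [<-|] //; rewrite -val_eqE neq_ltn => /orP[ij|ji].
    have /is_trig_mxP/(_ _ _ ij) := tYU.
    by rewrite trmx_mul trmxK.
  by have /is_trig_mxP/(_ _ _ ji) := tYU; rewrite mxE.
split.
  rewrite -dY trmx_mul trmxK trmx_inv !mulmxA mulmxV // mul1mx.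
  by rewrite mulmxKV ?unitmx_tr.
move=> i; rewrite lt_def luU_diag_neq0 //= -YUE mxE.
by apply: sumr_ge0 => k _; rewrite [Y^T _ _]mxE -expr2 sqr_ge0.
Qed.

(** The upper triangular Cholesky factor. Obtaining it from [luL] and [luU] reduces its
    differentiability to theirs and to that of the square root. *)
Definition chol S : 'M[R]_n :=
  diag_mx (\row_i Num.sqrt (luU S i i)) *m (luL S)^T.

Lemma chol_upper S : is_trig_mx (chol S)^T.
Proof.
rewrite trmx_mul trmxK tr_diag_mx trig_mulmx ?diag_mx_is_trig //.
by have [] := luL_unitrig S.
Qed.

Lemma chol_diag_gt0 X i : X \in unitmx -> 0 < chol (X^T *m X) i i.
Proof.
move=> uX; have [_ /(_ i) Ugt0] := gram_luE uX.
rewrite /chol mul_diag_mx !mxE; have [_ ->] := luL_unitrig (X^T *m X).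
by rewrite mulr1 sqrtr_gt0.
Qed.

Lemma chol_mul X : X \in unitmx ->
  (chol (X^T *m X))^T *m chol (X^T *m X) = X^T *m X.
Proof.
move=> uX; have [e Ugt0] := gram_luE uX.
rewrite [RHS]e /chol trmx_mul trmxK tr_diag_mx !mulmxA; congr (_ *m _).
rewrite -mulmxA mulmx_diag; congr (_ *m diag_mx _); apply/rowP => i.
by rewrite !mxE -expr2 sqr_sqrtr // ltW.
Qed.

(** For invertible [X] this equals [X R^-1] with [R] the Cholesky factor. The form [X^-T R^T]
    inverts [X] instead of [R], which pays off when [X] runs through a one-parameter group. *)
Definition qrQ X : 'M[R]_n := (invmx X)^T *m (chol (X^T *m X))^T.

Lemma chol_unitmx X : X \in unitmx -> chol (X^T *m X) \in unitmx.
Proof.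
move=> uX; rewrite -unitmx_tr trig_unitmx ?chol_upper //.
by apply/forallP => i; rewrite mxE gt_eqF ?chol_diag_gt0.
Qed.

Lemma qr_mul X : X \in unitmx -> qrQ X *m chol (X^T *m X) = X.
Proof.
move=> uX; rewrite /qrQ -mulmxA chol_mul // mulmxA -trmx_mul mulmxV //.
by rewrite trmx1 mul1mx.
Qed.

Lemma qrQ_orth X : X \in unitmx -> (qrQ X)^T *m qrQ X = 1%:M.
Proof.
move=> uX; have uR := chol_unitmx uX; set T := chol _ in uR *.
have -> : qrQ X = X *m invmx T by rewrite -{2}(qr_mul uX) mulmxK.
rewrite trmx_mul -mulmxA (mulmxA X^T) -chol_mul // -/T trmx_inv !mulmxA.
by rewrite mulVmx ?unitmx_tr // mul1mx mulmxV.
Qed.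

(** The transpose is the inverse and hence again lower triangular, so [X] is diagonal with positive
    entries of square 1. *)
Lemma trig_orth_eq1 X : is_trig_mx X -> (forall i, 0 < X i i) ->
  X^T *m X = 1%:M -> X = 1%:M.
Proof.
move=> tX X0 o; have tXT : is_trig_mx X^T by rewrite (orth_trmxE o) trig_invmx.
apply: unitrig_upper_eq1 => //; split=> // i.
have /matrixP/(_ i i) := o; rewrite trig_mulmx_diag // !mxE eqxx -expr2 => /eqP.
by rewrite sqrf_eq1 => /orP[/eqP //|/eqP e]; have := X0 i; rewrite e ltr0N1.
Qed.

End Cholesky.

(** * The linearizing variables *)

Section Positive.
Variables (R : realType) (n : nat).
Implicit Types A B G L M Q U X Y Z : 'M[R]_n.+1.

Lemma leading_minor_mul_lower G X k : is_trig_mx G ->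
  leading_minor (G *m X) k =
  (\prod_(i < k.+1) G (widen_ord (ltn_ord k) i) (widen_ord (ltn_ord k) i))
  * leading_minor X k.
Proof. exact: det_lead_mul_trig. Qed.

Lemma leading_minor_tr X k : leading_minor X^T k = leading_minor X k.
Proof. by rewrite [LHS]/leading_minor -/(lead _ _) lead_tr det_tr. Qed.

Lemma GLpos_mul_lower G X : is_trig_mx G -> (forall i, 0 < G i i) ->
  GLpos X -> GLpos (G *m X).
Proof.
move=> tG G0 [uX mX]; split.
  rewrite unitmx_mul uX andbT trig_unitmx //.
  by apply/forallP => i; rewrite gt_eqF.
by move=> k; rewrite leading_minor_mul_lower // mulr_gt0 // prodr_gt0.
Qed.

Lemma GLpos_tr X : GLpos X -> GLpos X^T.
Proof.
by case=> uX mX; split=> [|k]; rewrite ?unitmx_tr // leading_minor_tr.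
Qed.

Lemma GLpos_mul_upper X U : Uppos U -> GLpos X -> GLpos (X *m U).
Proof.
case=> tU U0 gX; rewrite -[_ *m _]trmxK trmx_mul; apply/GLpos_tr.
by apply: GLpos_mul_lower; [|move=> i; rewrite mxE|apply: GLpos_tr].
Qed.

(** Each leading minor of [G *m X] is that of [X] times a product of initial diagonal entries of
    [G]. Induction on [i] makes the earlier factors positive, which isolates the sign of [G i i]. *)
Lemma GLpos_diag_gt0 G X : is_trig_mx G -> GLpos X -> GLpos (G *m X) ->
  forall i, 0 < G i i.
Proof.
move=> tG [uX mX] [_ mGX] i.
have [m] := ubnP (i : nat); elim: m i => // m IH i; rewrite ltnS => im.
have := mGX i; rewrite leading_minor_mul_lower // pmulr_lgt0 //.
rewrite big_ord_recr /= pmulr_rgt0; last first.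
  apply: prodr_gt0 => j _; apply: IH.
  by apply: leq_trans im; apply: (ltn_ord j).
by congr (0 < G _ _); apply/val_inj.
Qed.

Lemma GLpos1 : GLpos (1%:M : 'M[R]_n.+1).
Proof.
split=> [|k]; first exact: unitmx1.
suff -> : leading_minor 1%:M k = 1 :> R by [].
transitivity (\det (1%:M : 'M[R]_k.+1)); last by rewrite det1.
by congr (\det _); apply/matrixP => i j; rewrite !mxE.
Qed.

Lemma GLpos_LU X : GLpos X -> exists L U, [/\ Lo1 L, Uppos U & X = L *m U].
Proof.
move=> gX; have rX : regular_minors X.
  move=> [|k] kn; first by rewrite det_mx00 oner_eq0.
  have [_ /(_ (Ordinal kn))/lt0r_neq0] := gX.
  congr (\det _ != 0); apply/matrixP => i j; rewrite !mxE.
  by congr (X _ _); apply/val_inj.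
exists (luL X), (luU X); split; [exact: luL_unitrig| |by rewrite lu_mul].
split; first exact: luU_upper.
move=> i; have e : (luU X) i i = (luU X)^T i i by rewrite [RHS]mxE.
rewrite e; move: i {e}.
(* Signs are read off the transposed identity [X^T = U^T L^T]: its left factor is lower triangular,
   and both [L^T] and [X^T] have positive minors. *)
apply: (@GLpos_diag_gt0 _ (luL X)^T); first exact: luU_upper.
  split=> [|k].
    by rewrite unitmx_tr unitrig_unitmx //; apply: luL_unitrig.
  rewrite leading_minor_tr -[luL X]mulmx1 leading_minor_mul_lower.
    rewrite big1 ?mul1r => [|i _]; last by have [_ ->] := luL_unitrig X.
    by have [_] := GLpos1; apply.
  by have [] := luL_unitrig X.
by rewrite -trmx_mul lu_mul //; apply: GLpos_tr.
Qed.

Lemma Opos_GLpos Q : Opos Q -> GLpos Q.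
Proof. by case=> /mulmx1_unit[]. Qed.

Lemma Uppos_unitmx U : Uppos U -> U \in unitmx.
Proof.
case=> tU U0; rewrite -unitmx_tr trig_unitmx //.
by apply/forallP => i; rewrite mxE gt_eqF.
Qed.

Lemma Uppos_mul U V : Uppos U -> Uppos V -> Uppos (U *m V).
Proof.
move=> [tU U0] [tV V0]; split; first by rewrite /upper /= trmx_mul trig_mulmx.
move=> i; have -> : (U *m V) i i = (U *m V)^T i i by rewrite [RHS]mxE.
by rewrite trmx_mul trig_mulmx_diag // !mxE mulr_gt0.
Qed.

Lemma Uppos_inv U : Uppos U -> Uppos (invmx U).
Proof.
move=> uU; have [tU U0] := uU.
split; first by rewrite /upper /= trmx_inv trig_invmx.
move=> i; have -> : invmx U i i = (invmx U)^T i i by rewrite [RHS]mxE.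
by rewrite trmx_inv trig_invmx_diag ?unitmx_tr ?Uppos_unitmx // mxE invr_gt0.
Qed.

Lemma lo0_add_diag Y (e : 'rV[R]_n.+1) : lo0 Y ->
  is_trig_mx (Y + diag_mx e) /\ forall i, (Y + diag_mx e) i i = e 0 i.
Proof.
move=> lY; split=> [|i]; last by rewrite !mxE lY // eqxx add0r.
apply/is_trig_mxP => i j ij.
by rewrite !mxE lY ?(ltnW ij) // -val_eqE ltn_eqF // add0r.
Qed.

Lemma lo0_sub_diag A (e : 'rV[R]_n.+1) : is_trig_mx A ->
  (forall i, A i i = e 0 i) -> lo0 (A - diag_mx e).
Proof.
move=> /is_trig_mxP tA Ae i j; rewrite leq_eqVlt => /orP[/eqP/val_inj ->|ij].
  by rewrite !mxE eqxx Ae subrr.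
by rewrite !mxE tA // -val_eqE ltn_eqF // subrr.
Qed.

(** If [f i = g j] with [j < i], then induction gives [f i < f j <= g j = f i], which is absurd; so
    [j >= i]. Used in both directions, this shows that a finite set of reals has only one decreasing
    enumeration. *)
Lemma strictly_decreasing_le (f g : 'I_n.+1 -> R) :
  strictly_decreasing f -> strictly_decreasing g ->
  (forall i, exists j, f i = g j) -> forall i, f i <= g i.
Proof.
move=> df dg fg i.
have [m] := ubnP (i : nat); elim: m i => // m IH i; rewrite ltnS => im.
have [j fgj] := fg i; have [ji|] := ltnP j i.
  by have := lt_le_trans (df _ _ ji) (IH j (leq_trans ji im)); rewrite fgj ltxx.
by rewrite fgj leq_eqVlt => /orP[/eqP/val_inj -> |/dg/ltW].
Qed.

(** The invertible [C = X X'^-1] intertwines the two diagonal matrices, so [C i j] vanishes unless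
    [e i = f j]. A value [e i] missing from [f] would make row [i] of [C] zero. *)
Lemma UGL_diag_spectrum (e f : 'rV[R]_n.+1) M :
  UGL (diag_mx e) M -> UGL (diag_mx f) M -> forall i, exists j, e 0 i = f 0 j.
Proof.
case=> X [uX _] ME [X' [uX' _] MF] i; pose C := X *m invmx X'.
have eC : diag_mx e *m C = C *m diag_mx f.
  rewrite -(mulKVmx uX (diag_mx e *m C)) !mulmxA -(mulmxA X).
  rewrite -(mulmxA X (_ *m _)).
  by rewrite -ME MF -!mulmxA mulmxV // mulmx1.
have uC : C \in unitmx by rewrite unitmx_mul uX unitmx_inv.
apply: contrapT => ne.
have /matrixP/(_ i i)/eqP := mulmxV uC.
rewrite !mxE eqxx big1 ?[0 == 1]eq_sym ?oner_eq0 // => j _.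
have /matrixP/(_ i j)/eqP := eC; rewrite mul_diag_mx mul_mx_diag !mxE.
rewrite [X in _ == X]mulrC -subr_eq0 -mulrBl mulf_eq0 subr_eq0.
case/orP => [/eqP eij|/eqP ->]; last by rewrite mul0r.
by case: ne; exists j.
Qed.

End Positive.

Section LinearizingVariables.
Variables (R : realType) (n : nat).
Implicit Types A B G L M Q U X Y Z : 'M[R]_n.+1.

Lemma perm_diag_inj (lam : 'I_n.+1 -> R) (s : 'S_n.+1) :
  strictly_decreasing lam -> injective (fun i => lam (s i)).
Proof.
move=> dl i j e; apply: (@perm_inj _ s); apply/val_inj.
by case: (ltngtP (s i) (s j)) => // /dl; rewrite e ltxx.
Qed.

(** The columns of [G = Q X^-1] are eigenvectors of the lower triangular [B], whose diagonal entries
    are distinct and in the order of the eigenvalues; hence [G] is lower triangular. The minors of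
    [X] and [Q = G X] give the signs. *)
Lemma orth_lower_factor (e : 'rV[R]_n.+1) M X B Q : injective (e 0) ->
  GLpos X -> M = invmx X *m diag_mx e *m X ->
  is_trig_mx B -> (forall i, B i i = e 0 i) ->
  Opos Q -> M = Q^T *m B *m Q ->
  is_trig_mx (Q *m invmx X) /\ forall i, 0 < (Q *m invmx X) i i.
Proof.
move=> ie gX ME tB Be oQ MB; have [uX _] := gX.
have [_ uQ] := mulmx1_unit oQ.1.
have QT := orth_trmxE oQ.1.
have eG : B *m (Q *m invmx X) = (Q *m invmx X) *m diag_mx e.
  have : Q *m M *m invmx X = B *m Q *m invmx X.
    by rewrite MB QT !mulmxA mulmxV // mul1mx.
  by rewrite ME !mulmxA mulmxK // => ->.
have tG : is_trig_mx (Q *m invmx X).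
  apply: (@trig_sylvester _ _ B _ (e 0)) => // i j ij.
    by rewrite Be (inj_eq ie) -val_eqE ltn_eqF.
  by rewrite eG mul_mx_diag mxE.
split=> //; apply: (GLpos_diag_gt0 tG gX).
by rewrite mulmxKV //; apply: Opos_GLpos.
Qed.

(** The quotient [G' G^-1 = (G' X) (G X)^-1] is orthogonal and lower triangular with positive
    diagonal, so [trig_orth_eq1] applies. *)
Lemma Opos_lower_unique G G' X : is_trig_mx G -> is_trig_mx G' ->
  (forall i, 0 < G i i) -> (forall i, 0 < G' i i) -> X \in unitmx ->
  (G *m X)^T *m (G *m X) = 1%:M -> (G' *m X)^T *m (G' *m X) = 1%:M ->
  G = G'.
Proof.
move=> tG tG' G0 G0' uX o o'.
have uG : G \in unitmx.
  by rewrite trig_unitmx //; apply/forallP => i; rewrite gt_eqF.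
suff : G' *m invmx G = 1%:M.
  by move/(congr1 (mulmx^~ G)); rewrite mulmxKV // mul1mx.
apply: trig_orth_eq1.
- by rewrite trig_mulmx ?trig_invmx.
- move=> i; rewrite trig_mulmx_diag ?trig_invmx ?trig_invmx_diag //.
  by rewrite mulr_gt0 ?invr_gt0.
have -> : G' *m invmx G = (G' *m X) *m invmx (G *m X).
  rewrite invmx_mul // ?unitmx_mul ?uG //.
  by rewrite mulmxA mulmxK.
move: o'; set W := G' *m X => o'.
rewrite (trmx_mul W) -mulmxA (mulmxA W^T) o' mul1mx -(orth_trmxE o).
by rewrite trmxK mulmx1C.
Qed.

Lemma linearizing_variables_unique s M v v' :
  linearizing_variables s M v -> linearizing_variables s M v' -> v = v'.
Proof.
case: v => [[E Y] Z]; case: v' => [[E' Y'] Z'].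
case=> -[lam dl EE] ugl lY lZ [Q [L [U [oQ lL pU QE [MQ ZE]]]]].
case=> -[lam' dl' EE'] ugl' lY' lZ' [Q' [L' [U' [oQ' lL' pU' QE' [MQ' ZE']]]]].
(* Both diagonals carry the spectrum of [M]. Evaluating at [s^-1 i] undoes the permutation and
   leaves two decreasing enumerations of the same values. *)
have eE : E = E'.
  rewrite perm_diagE in EE; rewrite perm_diagE in EE'.
  rewrite EE in ugl; rewrite EE' in ugl'.
  have sp := UGL_diag_spectrum ugl ugl'; have sp' := UGL_diag_spectrum ugl' ugl.
  have ll' i : exists j, lam i = lam' j.
    have [j] := sp ((s^-1)%g i); rewrite !mxE permKV => ->; by exists (s j).
  have ll i : exists j, lam' i = lam j.
    have [j] := sp' ((s^-1)%g i); rewrite !mxE permKV => ->; by exists (s j).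
  rewrite EE EE'; congr diag_mx; apply/rowP => i; rewrite !mxE.
  by apply/eqP; rewrite eq_le !strictly_decreasing_le.
move: ugl EE MQ' ZE'; rewrite -eE perm_diagE => -[X gX MX] EE MQ' ZE'.
rewrite EE in MX MQ ZE MQ' ZE'; have [uX _] := gX.
set e := \row_i _ in EE MX MQ ZE MQ' ZE'.
have ie : injective (e 0).
  by move=> i j; rewrite !mxE; apply: perm_diag_inj.
have [tB Be] := lo0_add_diag e lY; have [tB' Be'] := lo0_add_diag e lY'.
have [tG G0] := orth_lower_factor ie gX MX tB Be oQ MQ.
have [tG' G0'] := orth_lower_factor ie gX MX tB' Be' oQ' MQ'.
have eQ : Q = Q'.
  rewrite -(mulmxKV uX Q) -(mulmxKV uX Q'); congr (_ *m _).
  apply: (Opos_lower_unique tG tG' G0 G0' uX); rewrite !mulmxKV //.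
    by case: oQ.
  by case: oQ'.
have [eL _] : L = L' /\ U = U'.
  apply: LU_unique; rewrite ?Uppos_unitmx -?QE -?QE' //.
    by case: pU.
  by case: pU'.
have eY : Y = Y'.
  have conjE (P C : 'M[R]_n.+1) :
      Opos P -> M = P^T *m C *m P -> C = P *m M *m P^T.
    case=> /mulmx1C PP _ ->.
    by rewrite !mulmxA PP mul1mx -mulmxA PP mulmx1.
  apply: (@addIr _ (diag_mx e)).
  by rewrite (conjE _ _ oQ MQ) (conjE _ _ oQ' MQ') eQ.
have eZ : Z = Z'.
  by apply: (@addIr _ (diag_mx e)); rewrite ZE ZE' eL eY.
by rewrite eE eY eZ.
Qed.

(** A QR factorization of [X^T] reads [X = C^T Q] with [C^T] lower triangular. Conjugating the
    diagonal matrix by [C^T] gives [Y + E], and conjugating further by the LU factor [L] of [Q]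
    gives [Z + E]. *)
Lemma linearizing_variables_exist (lam : 'I_n.+1 -> R) s M :
  strictly_decreasing lam -> UGL (perm_diag lam s) M ->
  exists Y Z, linearizing_variables s M (perm_diag lam s, Y, Z).
Proof.
move=> dl ugl; have := ugl; rewrite perm_diagE; set e := \row_i _.
case=> X gX MX; have [uX _] := gX.
have uXT : X^T \in unitmx by rewrite unitmx_tr.
pose C := chol (X^T^T *m X^T); pose Q := (qrQ X^T)^T.
have uC : C^T \in unitmx by rewrite unitmx_tr chol_unitmx.
have XE : X = C^T *m Q by rewrite -trmx_mul qr_mul // trmxK.
have QE : Q = invmx C^T *m X by rewrite XE mulKmx.
have tC : is_trig_mx C^T by apply: chol_upper.
have C0 i : 0 < C^T i i by rewrite mxE chol_diag_gt0.
have orQ : Q^T *m Q = 1%:M by rewrite mulmx1C // trmxK qrQ_orth.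
have gQ : GLpos Q.
  by rewrite QE; apply: GLpos_mul_lower; rewrite ?trig_invmx // => i;
     rewrite trig_invmx_diag // invr_gt0.
have oQ : Opos Q by split=> //; case: gQ.
pose B := invmx C^T *m diag_mx e *m C^T.
have tB : is_trig_mx B by rewrite !trig_mulmx ?trig_invmx ?diag_mx_is_trig.
have Be i : B i i = e 0 i.
  rewrite !trig_mulmx_diag ?trig_mulmx ?trig_invmx ?diag_mx_is_trig //.
  rewrite trig_invmx_diag // [diag_mx _ _ _]mxE eqxx mulrAC mulVf ?mul1r //.
  by rewrite gt_eqF.
have MB : M = Q^T *m B *m Q.
  rewrite (orth_trmxE orQ) QE invmx_mul ?unitmx_inv // invmxK MX /B !mulmxA.
  by rewrite !mulmxK.
have [L [U [lL pU QLU]]] := GLpos_LU gQ.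
have uL : L \in unitmx by apply: unitrig_unitmx.
have [tL L1] := lL.
pose A := invmx L *m B *m L.
have tA : is_trig_mx A by rewrite !trig_mulmx ?trig_invmx.
have Ae i : A i i = e 0 i.
  rewrite trig_mulmx_diag ?trig_mulmx ?trig_invmx //.
  rewrite trig_mulmx_diag ?trig_invmx // trig_invmx_diag //.
  by rewrite L1 Be invr1 mul1r mulr1.
exists (B - diag_mx e), (A - diag_mx e); split=> //.
- by exists lam => //; rewrite perm_diagE.
- by rewrite -perm_diagE.
- exact: lo0_sub_diag.
- exact: lo0_sub_diag.
by exists Q, L, U; rewrite !subrK.
Qed.

End LinearizingVariables.

(** * Effect of a QR step on the linearizing variables *)

Section LinearizingFlow.
Variables (R : realType) (n : nat).
Implicit Types A B G L M Q T U X Y Z : 'M[R]_n.+1.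

Lemma UGL_conj_upper E M T : Uppos T -> UGL E M -> UGL E (T *m M *m invmx T).
Proof.
move=> pT [X gX ->]; exists (X *m invmx T).
  by apply: GLpos_mul_upper => //; apply: Uppos_inv.
have uT := Uppos_unitmx pT; have [uX _] := gX.
by rewrite invmx_mul ?unitmx_inv // invmxK !mulmxA.
Qed.

Lemma diag_mxC (d e : 'rV[R]_n.+1) :
  diag_mx d *m diag_mx e = diag_mx e *m diag_mx d.
Proof.
by rewrite !mulmx_diag; congr diag_mx; apply/rowP => i; rewrite !mxE mulrC.
Qed.

Section QRStep.
Variables (d e : 'rV[R]_n.+1) (M X Q T : 'M[R]_n.+1).
Hypotheses (uX : X \in unitmx) (ME : M = invmx X *m diag_mx e *m X).
Hypotheses (oQ : Q^T *m Q = 1%:M) (uT : T \in unitmx).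
Hypothesis QT : Q *m T = invmx X *m diag_mx d *m X.

(** [Q *m T] is diagonalized by the same [X] as [M], so the two commute, and conjugating [M] by [Q]
    on one side amounts to conjugating by [T] on the other. *)
Lemma qr_step_conj : Q^T *m M *m Q = T *m M *m invmx T.
Proof.
have [_ uQ] := mulmx1_unit oQ.
have MC : M *m (Q *m T) = Q *m T *m M.
  rewrite QT ME !mulmxA !mulmxK //.
  by rewrite -(mulmxA _ (diag_mx e) (diag_mx d)) diag_mxC mulmxA.
rewrite (orth_trmxE oQ) -[LHS](mulmxK uT); congr (_ *m _).
by rewrite -!mulmxA MC -(mulmxA Q) mulKmx.
Qed.

End QRStep.

(** Let [Q0 = G X] be the orthogonal factor of [M] and [W = G D G^-1]. Then [W] commutes with
    [B = Y + E], and [Q0 Q = W Q0 T^-1]. The new orthogonal factor is [Q0 Q] with the same [B],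
    while its LU factorization changes by [W] and [D], which conjugates [Z + E] by [D]. *)
Lemma linearizing_variables_flow (lam : 'I_n.+1 -> R) s M X (d : 'rV[R]_n.+1)
    Q T Y Z :
  (forall i, 0 < d 0 i) -> GLpos X -> M = invmx X *m perm_diag lam s *m X ->
  Q^T *m Q = 1%:M -> Uppos T -> Q *m T = invmx X *m diag_mx d *m X ->
  linearizing_variables s M (perm_diag lam s, Y, Z) ->
  linearizing_variables s (Q^T *m M *m Q)
    (perm_diag lam s, Y, diag_mx d *m Z *m invmx (diag_mx d)).
Proof.
move=> d0 gX; rewrite perm_diagE; set e := \row_i _ => ME oQ pT QT.
case=> -[lam' dl' Ee] ugl lY lZ [Q0 [L [U [oQ0 lL pU QLU [MQ ZE]]]]].
have uT := Uppos_unitmx pT; have [uX _] := gX; have [tL L1] := lL.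
have uL : L \in unitmx by apply: unitrig_unitmx.
have tD := diag_mx_is_trig d; set D := diag_mx d in tD QT *.
have D0 i : D i i = d 0 i by rewrite mxE eqxx.
have uD : D \in unitmx.
  by rewrite trig_unitmx //; apply/forallP => i; rewrite D0 gt_eqF.
have pD : Uppos D by split; [rewrite /upper /= tr_diag_mx|move=> i; rewrite D0].
have De : D *m diag_mx e = diag_mx e *m D by apply: diag_mxC.
have [tB Be] := lo0_add_diag e lY; set B := Y + _ in MQ ZE tB Be.
have ie : injective (e 0).
  move: Ee; rewrite perm_diagE => Ee i j; have ed k : e 0 k = lam' (s k).
    by have /matrixP/(_ k k) := Ee; rewrite !mxE eqxx.
  by rewrite !ed; apply: perm_diag_inj.
have [tG G0] := orth_lower_factor ie gX ME tB Be oQ0 MQ.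
have Q0E : Q0 = (Q0 *m invmx X) *m X by rewrite mulmxKV.
move: (Q0 *m invmx X) tG G0 Q0E => G tG G0 Q0E.
have uG : G \in unitmx.
  by rewrite trig_unitmx //; apply/forallP => i; rewrite gt_eqF.
pose W := G *m D *m invmx G.
have tW : is_trig_mx W by rewrite !trig_mulmx ?trig_invmx.
have WE i : W i i = d 0 i.
  rewrite trig_mulmx_diag ?trig_mulmx ?trig_invmx // trig_mulmx_diag //.
  by rewrite trig_invmx_diag // D0 mulrAC divff ?mul1r ?gt_eqF.
have uW : W \in unitmx.
  by rewrite trig_unitmx //; apply/forallP => i; rewrite WE gt_eqF.
have Q0T : Q0^T = invmx Q0 by case: oQ0 => /orth_trmxE.
have [_ uQ0] := mulmx1_unit oQ0.1.
have BE : B = G *m diag_mx e *m invmx G.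
  have -> : B = Q0 *m M *m invmx Q0.
    by rewrite MQ Q0T !mulmxA mulmxV // mul1mx mulmxK.
  by rewrite ME Q0E invmx_mul // !mulmxA !mulmxK.
have BW : B *m W = W *m B.
  rewrite BE /W !mulmxA !(mulmxKV uG); congr (_ *m _).
  by rewrite -!mulmxA De.
have QE : Q0 *m Q = W *m Q0 *m invmx T.
  rewrite -[LHS](mulmxK uT); congr (_ *m _).
  by rewrite -mulmxA QT Q0E /W !mulmxA mulmxK // mulmxKV.
have oQQ : (Q0 *m Q)^T *m (Q0 *m Q) = 1%:M.
  by rewrite trmx_mul -mulmxA (mulmxA Q0^T) oQ0.1 mul1mx.
split=> //.
- by exists lam'.
- by rewrite (qr_step_conj uX ME oQ uT QT); apply: UGL_conj_upper.
- move=> i j ij; have -> : invmx D = diag_mx (\row_k (d 0 k)^-1).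
    rewrite -[RHS](mulKmx uD) mulmx_diag -[LHS]mulmx1; congr (_ *m _).
    by apply/matrixP => k l; rewrite !mxE divff // gt_eqF.
  by rewrite mul_mx_diag mul_diag_mx !mxE lZ // mulr0 mul0r.
(* [W] has diagonal [d], so [D^-1] is inserted to make the lower factor unitriangular, and [D]
   compensates in the upper factor. *)
exists (Q0 *m Q), (W *m L *m invmx D), (D *m U *m invmx T); split.
- split=> // k; have [_] : GLpos (Q0 *m Q); last exact.
  rewrite QE; apply: GLpos_mul_upper; first exact: Uppos_inv.
  by apply: GLpos_mul_lower; [|move=> i; rewrite WE|apply: Opos_GLpos].
- split; first by rewrite !trig_mulmx ?trig_invmx.
  move=> i; rewrite trig_mulmx_diag ?trig_mulmx ?trig_invmx //.
  rewrite trig_mulmx_diag // trig_invmx_diag // L1 WE D0 mulr1 divff //.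
  by rewrite gt_eqF.
- by apply: Uppos_mul; [apply: Uppos_mul|apply: Uppos_inv].
- by rewrite QE QLU !mulmxA mulmxKV.
rewrite -/B; split; first by rewrite MQ trmx_mul !mulmxA.
clearbody W B.
have -> : diag_mx e = D *m diag_mx e *m invmx D by rewrite De mulmxK.
rewrite -mulmxDl -mulmxDr ZE !invmx_mul ?unitmx_mul ?unitmx_inv ?uW //.
rewrite invmxK -!mulmxA; congr (_ *m (_ *m _)).
by rewrite !mulmxA -(mulmxA _ B) BW mulmxA mulVmx // mul1mx.
Qed.

End LinearizingFlow.

(** * The explicit solution *)

Section MatrixCalculus.
Variable R : realType.

Lemma is_derive_mxP m n (M : R -> 'M[R]_(m, n)) (dM : 'M[R]_(m, n)) (t : R) :
  is_derive t 1 M dM <-> forall i j, is_derive t 1 (fun x => M x i j) (dM i j).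
Proof.
split=> [[dm <-] i j|dM_].
  have /derivable_mxP dij := dm.
  by apply: DeriveDef; [exact: dij|rewrite derive_mx // mxE].
have dm : derivable M t 1 by apply/derivable_mxP => i j; case: (dM_ i j).
apply: DeriveDef => //; rewrite derive_mx //; apply/matrixP => i j.
by rewrite mxE; case: (dM_ i j).
Qed.

Lemma is_derive_bigsum n (f : 'I_n -> R -> R) (df : 'I_n -> R) (t : R) :
  (forall i, is_derive t 1 (f i) (df i)) ->
  is_derive t 1 (fun x => \sum_i f i x) (\sum_i df i).
Proof. by move=> dfi; rewrite -fct_sumE; apply: is_derive_sum. Qed.

Lemma is_derive_mulmx m n k (A : R -> 'M[R]_(m, n)) (B : R -> 'M[R]_(n, k))
    dA dB (t : R) :
  is_derive t 1 A dA -> is_derive t 1 B dB ->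
  is_derive t 1 (fun x => A x *m B x) (dA *m B t + A t *m dB).
Proof.
move=> /is_derive_mxP dA_ /is_derive_mxP dB_; apply/is_derive_mxP => i j.
rewrite !mxE -big_split /=; under eq_fun do rewrite mxE.
apply: is_derive_bigsum => l.
apply: is_derive_eq (is_deriveM (dA_ i l) (dB_ l j)) _.
by rewrite addrC [_ *: dA i l]mulrC.
Qed.

Lemma is_derive_trmx m n (A : R -> 'M[R]_(m, n)) dA (t : R) :
  is_derive t 1 A dA -> is_derive t 1 (fun x => (A x)^T) dA^T.
Proof.
move=> /is_derive_mxP dA_; apply/is_derive_mxP => i j; rewrite mxE.
by under eq_fun do rewrite mxE.
Qed.

Lemma is_derive_mulmxl m n k (A : 'M[R]_(m, n)) (B : R -> 'M[R]_(n, k))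
    dB (t : R) :
  is_derive t 1 B dB -> is_derive t 1 (fun x => A *m B x) (A *m dB).
Proof.
move=> dB_; apply: is_derive_eq (is_derive_mulmx (is_derive_cst A t 1) dB_) _.
by rewrite mul0mx add0r.
Qed.

Lemma is_derive_mulmxr m n k (A : R -> 'M[R]_(m, n)) (B : 'M[R]_(n, k))
    dA (t : R) :
  is_derive t 1 A dA -> is_derive t 1 (fun x => A x *m B) (dA *m B).
Proof.
move=> dA_; apply: is_derive_eq (is_derive_mulmx dA_ (is_derive_cst B t 1)) _.
by rewrite mulmx0 addr0.
Qed.

Lemma derivable_schur n (A : R -> 'M[R]_(1 + n)) (t : R) : A t 0 0 != 0 ->
  derivable A t 1 -> derivable (fun x => schur (A x)) t 1.
Proof.
move=> a0 /derivable_mxP dA; apply/derivable_mxP => i j.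
have -> : (fun x => schur (A x) i j) =
    (fun x => A x (rshift 1 i) (rshift 1 j)) -
    (fun x => (A x 0 0)^-1) * ((fun x => A x (rshift 1 i) (lshift n 0))
      * (fun x => A x (lshift n 0) (rshift 1 j))).
  by apply/funext => x; rewrite !mxE big_ord1 !mxE.
apply: derivableB; first exact: dA.
apply: derivableM; last by apply: derivableM; exact: dA.
by apply: derivableV => //; exact: dA.
Qed.

(** The entries of both factors are rational in those of [A], and the denominators are pivots, which
    are nonzero at [t]. *)
Lemma derivable_lu n (A : R -> 'M[R]_n) (t : R) : regular_minors (A t) ->
  derivable A t 1 ->
  derivable (fun x => luL (A x)) t 1 /\ derivable (fun x => luU (A x)) t 1.
Proof.
elim: n A => [|n IH] A rA dA; first by split.
have a0 := regular_minors00 rA.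
have [] := IH _ (regular_minors_schur rA) (derivable_schur a0 dA).
move: dA => /derivable_mxP dA /derivable_mxP dL /derivable_mxP dU.
split; apply/derivable_mxP => i j /=.
  case: (@split_ordP 1 n i) => {}i ->; case: (@split_ordP 1 n j) => {}j ->.
  - under eq_fun do rewrite (@block_mxEul _ 1 n 1 n); exact: derivable_cst.
  - under eq_fun do rewrite (@block_mxEur _ 1 n 1 n); exact: derivable_cst.
  - under eq_fun do rewrite (@block_mxEdl _ 1 n 1 n) !mxE.
    apply: (@derivableM _ _ (fun x => (A x 0 0)^-1)); last exact: dA.
    by apply: derivableV => //; exact: dA.
  - under eq_fun do rewrite (@block_mxEdr _ 1 n 1 n); exact: dL.
case: (@split_ordP 1 n i) => {}i ->; case: (@split_ordP 1 n j) => {}j ->.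
- under eq_fun do rewrite (@block_mxEul _ 1 n 1 n) !mxE; exact: dA.
- under eq_fun do rewrite (@block_mxEur _ 1 n 1 n) !mxE; exact: dA.
- under eq_fun do rewrite (@block_mxEdl _ 1 n 1 n) !mxE; exact: derivable_cst.
- under eq_fun do rewrite (@block_mxEdr _ 1 n 1 n); exact: dU.
Qed.

(** The arguments of the square roots are positive at [t] by [gram_luE], away from the singularity
    at 0. *)
Lemma derivable_chol n (X : R -> 'M[R]_n) (t : R) : X t \in unitmx ->
  derivable X t 1 -> derivable (fun x => chol ((X x)^T *m X x)) t 1.
Proof.
move=> uX dX; pose S x := (X x)^T *m X x.
have dS : derivable S t 1.
  have dXv := derivableP dX.
  by case: (is_derive_mulmx (is_derive_trmx dXv) dXv).
have [/derivable_mxP dL /derivable_mxP dU] := derivable_lu (gram_regular uX) dS.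
have [_ U0] := gram_luE uX.
apply/derivable_mxP => i j.
rewrite /chol; under eq_fun do rewrite mul_diag_mx !mxE.
apply: (@derivableM _ _ (fun x => Num.sqrt (luU (S x) i i))); last exact: dL.
have h := is_derive1_comp (is_derive1_sqrt (U0 i)) (derivableP (dU i i)).
by case: h.
Qed.

End MatrixCalculus.

(** * The Toda flow by QR factorization of an exponential *)

Section TodaSolution.
Variables (R : realType) (n : nat) (e : 'rV[R]_n.+1) (X : 'M[R]_n.+1).
Variable p : {poly R}.
Hypothesis uX : X \in unitmx.

Definition toda_init : 'M[R]_n.+1 := invmx X *m diag_mx e *m X.

Definition exp_row (t : R) : 'rV[R]_n.+1 := \row_i expR (t * p.[e 0 i]).

Definition exp_curve t : 'M[R]_n.+1 := invmx X *m diag_mx (exp_row t) *m X.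

Definition toda_R t : 'M[R]_n.+1 := chol ((exp_curve t)^T *m exp_curve t).

Definition toda_Q t : 'M[R]_n.+1 := qrQ (exp_curve t).

Definition toda_flow t : 'M[R]_n.+1 :=
  (toda_Q t)^T *m toda_init *m toda_Q t.

Lemma exp_curveN t : exp_curve (- t) *m exp_curve t = 1%:M.
Proof.
rewrite /exp_curve !mulmxA mulmxK // -(mulmxA (invmx X)) mulmx_diag.
rewrite (_ : diag_mx _ = 1%:M) ?mulmx1 ?mulVmx //.
apply/matrixP => i j; rewrite !mxE -expRD mulNr addNr expR0.
by case: eqVneq.
Qed.

Lemma exp_curve_unitmx t : exp_curve t \in unitmx.
Proof. by case: (mulmx1_unit (exp_curveN t)). Qed.

Lemma exp_curve0 : exp_curve 0 = 1%:M.
Proof.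
rewrite /exp_curve (_ : diag_mx _ = 1%:M) ?mulmx1 ?mulVmx //.
by apply/matrixP => i j; rewrite !mxE mul0r expR0.
Qed.

Lemma invmx_exp_curve t : invmx (exp_curve t) = exp_curve (- t).
Proof. by rewrite -[RHS](mulmxK (exp_curve_unitmx t)) exp_curveN mul1mx. Qed.

Lemma horner_toda_init : horner_mx toda_init p =
  invmx X *m diag_mx (\row_i p.[e 0 i]) *m X.
Proof.
rewrite horner_mx_uconjC // horner_mx_diag; congr (_ *m diag_mx _ *m _).
by apply/rowP => i; rewrite !mxE.
Qed.

Lemma is_derive_exp_curve (t : R) :
  is_derive t 1 exp_curve (horner_mx toda_init p *m exp_curve t).
Proof.
rewrite horner_toda_init.
have -> : invmx X *m diag_mx (\row_i p.[e 0 i]) *m X *m exp_curve t =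
    invmx X *m (diag_mx (\row_i p.[e 0 i]) *m diag_mx (exp_row t)) *m X.
  by rewrite /exp_curve !mulmxA mulmxK.
apply: is_derive_mulmxr; apply: is_derive_mulmxl; apply/is_derive_mxP => i j.
rewrite mulmx_diag !mxE; under eq_fun do rewrite !mxE.
have h : is_derive t 1 (fun x : R => x * p.[e 0 i]) p.[e 0 i].
  have := is_deriveM (is_derive_id t 1) (is_derive_cst p.[e 0 i] t 1).
  by move=> /is_derive_eq; apply; rewrite scaler0 add0r [_ *: _]mulr1.
have h' := @is_derive1_comp _ expR (fun x => x * p.[e 0 i]) t _ _
  (is_derive_expR _) h.
case: eqVneq => _ /=; last exact: is_derive_cst.
by apply: is_derive_eq h' _; rewrite mulr1n mulrC.
Qed.

Lemma toda_QR t : toda_Q t *m toda_R t = exp_curve t.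
Proof. exact/qr_mul/exp_curve_unitmx. Qed.

Lemma toda_Q_orth t : (toda_Q t)^T *m toda_Q t = 1%:M.
Proof. exact/qrQ_orth/exp_curve_unitmx. Qed.

Lemma toda_R_Uppos t : Uppos (toda_R t).
Proof.
split; first exact: chol_upper.
by move=> i; apply: chol_diag_gt0; apply: exp_curve_unitmx.
Qed.

Lemma toda_R_derivable (t : R) : derivable toda_R t 1.
Proof.
apply: derivable_chol; first exact: exp_curve_unitmx.
by case: (is_derive_exp_curve t).
Qed.

Lemma toda_Q_derivable (t : R) : derivable toda_Q t 1.
Proof.
(* The inverse of the exponential at [x] is its value at [- x], so no matrix inverse has to be
   differentiated. *)
have -> : toda_Q = fun x => (exp_curve (- x))^T *m (toda_R x)^T.
  by apply/funext => x; rewrite -invmx_exp_curve.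
have dR := derivableP (@toda_R_derivable t).
have dN : derivable (fun x => exp_curve (- x)) t 1.
  apply/derivable_mxP => i j.
  have /is_derive_mxP/(_ i j) dE := is_derive_exp_curve (- t).
  by case: (@is_derive1_comp _ (fun x => exp_curve x i j) -%R t _ _ dE _).
by case: (is_derive_mulmx (is_derive_trmx (derivableP dN)) (is_derive_trmx dR)).
Qed.

Lemma toda_flowE t : toda_flow t = toda_R t *m toda_init *m invmx (toda_R t).
Proof.
apply: (qr_step_conj uX) (toda_Q_orth t) _ (toda_QR t) => //.
exact/Uppos_unitmx/toda_R_Uppos.
Qed.

Lemma toda_flow0 : toda_flow 0 = toda_init.
Proof.
(* At time 0 the product [Q R] is the identity, so the orthogonal [Q = R^-1] is upper triangular
   with positive diagonal. *)
have Q1 : toda_Q 0 = 1%:M.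
  have uR := toda_R_Uppos 0; have QR := toda_QR 0; rewrite exp_curve0 in QR.
  have QE : (toda_Q 0)^T^T = invmx (toda_R 0).
    by rewrite trmxK -[LHS](mulmxK (Uppos_unitmx uR)) QR mul1mx.
  have [tV V0] := Uppos_inv uR; rewrite -QE in tV V0.
  have := @trig_orth_eq1 _ _ (toda_Q 0)^T; rewrite trmxK.
  rewrite /upper /= !trmxK in tV V0.
  move=> h; apply: trmx_inj; rewrite trmx1; apply: h => //.
    by move=> i; rewrite mxE.
  exact/mulmx1C/toda_Q_orth.
by rewrite /toda_flow Q1 trmx1 mul1mx mulmx1.
Qed.

Lemma toda_flow_skew (t : R) :
  (toda_Q t)^T *m 'D_1 toda_Q t = proj_skew (horner_mx (toda_flow t) p).
Proof.
have dQ := derivableP (@toda_Q_derivable t).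
set Q := toda_Q t in dQ *; set dQt := 'D_1 toda_Q t in dQ *.
have oQ : Q^T *m Q = 1%:M := toda_Q_orth t.
have sk : dQt^T *m Q = - (Q^T *m dQt).
  have := is_derive_mulmx (is_derive_trmx dQ) dQ.
  under eq_fun do rewrite toda_Q_orth.
  case=> _; rewrite derive_cst => /esym/eqP; rewrite addr_eq0 => /eqP //.
apply/proj_skewP; split; first by rewrite /Defs.skew /= trmx_mul trmxK sk.
have uR := Uppos_unitmx (toda_R_Uppos t).
pose dR := 'D_1 toda_R t.
(* The product rule for [R = Q^T exp_curve]; multiplied by [R^-1] on the right, it yields
   [p(M) - Q^T Q'], since [Q'^T Q = - Q^T Q']. *)
have dRE : dR = dQt^T *m exp_curve t +
    Q^T *m (horner_mx toda_init p *m exp_curve t).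
  have h := is_derive_mulmx (is_derive_trmx dQ) (is_derive_exp_curve t).
  have RE : (fun x => (toda_Q x)^T *m exp_curve x) = toda_R.
    by apply/funext => x; rewrite -toda_QR mulmxA toda_Q_orth mul1mx.
  by rewrite RE in h; case: h.
have pM : horner_mx (toda_flow t) p = Q^T *m horner_mx toda_init p *m Q.
  rewrite /toda_flow -/Q (orth_trmxE oQ) horner_mx_uconjC //.
  by case: (mulmx1_unit oQ).
have -> : horner_mx (toda_flow t) p - Q^T *m dQt = dR *m invmx (toda_R t).
  rewrite dRE pM; move: (toda_QR t) uR; rewrite -/Q.
  clear dRE pM dQ; clearbody dQt Q; move: (toda_R t) => T <- uT.
  move: (horner_mx _ p) => P; rewrite mulmxDl !mulmxA !mulmxK // sk.
  by rewrite addrC.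
have udR : is_trig_mx dR^T.
  apply/is_trig_mxP => i j ij; rewrite mxE.
  have /is_derive_mxP/(_ j i) := derivableP (@toda_R_derivable t).
  have -> : (fun x => toda_R x j i) = cst 0.
    apply/funext => x; have [/is_trig_mxP/(_ _ _ ij)] := toda_R_Uppos x.
    by rewrite mxE.
  by case=> _; rewrite derive_cst.
rewrite /upper /= trmx_mul; apply: trig_mulmx => //.
by rewrite trmx_inv; apply: trig_invmx; case: (toda_R_Uppos t).
Qed.

(** With [K = Q^T Q'] one has [Q' = Q K], so the derivative of [Q^T M0 Q] is [K^T M + M K], which is
    the bracket of [M] and [K] because [K] is skew. *)
Lemma toda_flow_solution : toda_solution p setT toda_flow.
Proof.
move=> t _; rewrite /lie_bracket -toda_flow_skew.
have dQ := derivableP (@toda_Q_derivable t).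
have h := is_derive_mulmx (is_derive_mulmxr toda_init (is_derive_trmx dQ)) dQ.
apply: is_derive_eq h _; rewrite /toda_flow.
have : Defs.skew ((toda_Q t)^T *m 'D_1 toda_Q t).
  rewrite toda_flow_skew.
  by have [] := (proj_skewP (horner_mx (toda_flow t) p) _).1 erefl.
have QQ := mulmx1C (toda_Q_orth t).
rewrite /Defs.skew /= trmx_mul trmxK.
move: (toda_Q t) ('D_1 toda_Q t) toda_init QQ => Q dQt M0 QQ sk.
rewrite addrC !mulmxA -[Q^T *m _ *m Q *m Q^T]mulmxA QQ mulmx1; congr (_ + _).
rewrite -[Q^T *m dQt]opprK -sk !mulNmx opprK.
by rewrite -[dQt^T *m Q *m Q^T]mulmxA QQ mulmx1.
Qed.

End TodaSolution.

(** * Uniqueness of solutions *)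

Section ODEUniqueness.
Variable R : realType.

(** The mean value theorem compares the end values of [e y * expR (k * y)]. For [k = - L] the
    product does not increase, which carries a zero forward; for [k = L] it does not decrease, which
    carries a zero backward. *)
Lemma gronwall_eq0 (e de : R -> R) (a b L : R) : a <= b ->
  (forall x, x \in `[a, b]%R -> is_derive x 1 e (de x)) ->
  (forall x, x \in `[a, b]%R -> 0 <= e x) ->
  (forall x, x \in `[a, b]%R -> `|de x| <= L * e x) ->
  (e a = 0 -> e b = 0) /\ (e b = 0 -> e a = 0).
Proof.
move=> ab dE e0 eL.
have wexp (k x : R) : x \in `[a, b]%R ->
    is_derive x 1 (fun y => e y * expR (k * y))
      ((de x + k * e x) * expR (k * x)).
  move=> xab.
  have hk : is_derive x 1 (fun y : R => k * y) k.
    have := is_deriveM (is_derive_cst k x 1) (is_derive_id x 1).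
    by move=> /is_derive_eq; apply; rewrite scaler0 addr0 [_ *: _]mulr1.
  have hx := @is_derive1_comp _ expR (fun y => k * y) x _ _
    (is_derive_expR _) hk.
  apply: is_derive_eq (is_deriveM (dE x xab) hx) _ => /=.
  by rewrite /GRing.scale /=; ring.
have mvt k : exists2 c, c \in `[a, b]%R &
    e b * expR (k * b) - e a * expR (k * a) =
    (de c + k * e c) * expR (k * c) * (b - a).
  pose h y := e y * expR (k * y); pose dh x := (de x + k * e x) * expR (k * x).
  have hD x : x \in `]a, b[%R -> is_derive x 1 h (dh x).
    by move=> xab; apply: wexp; apply: subset_itv_oo_cc.
  have hC : {within `[a, b], continuous h}.
    by apply: derivable_within_continuous => x xab; case: (wexp k x xab).
  by have [c cI hc] := MVT_segment ab hD hC; exists c.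
have aI : a \in `[a, b]%R by rewrite in_itv /= lexx ab.
have bI : b \in `[a, b]%R by rewrite in_itv /= lexx ab.
have ba0 : 0 <= b - a by rewrite subr_ge0.
split=> ez; apply/eqP; rewrite eq_le e0 // andbT.
  have [c cI] := mvt (- L); rewrite ez mul0r subr0 => h.
  rewrite -(pmulr_lle0 _ (expR_gt0 (- L * b))) h mulr_le0_ge0 //.
  rewrite mulr_le0_ge0 ?expR_ge0 // mulNr subr_le0.
  by rewrite (le_trans (ler_norm _)) // eL.
have [c cI] := mvt L; rewrite ez mul0r sub0r => h.
rewrite -(pmulr_lle0 _ (expR_gt0 (L * a))) -oppr_ge0 h mulr_ge0 //.
rewrite mulr_ge0 ?expR_ge0 // -lerBlDr sub0r lerNl.
by rewrite (le_trans (ler_norm _)) // normrN eL.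
Qed.

End ODEUniqueness.

(** * Local Lipschitz bounds and uniqueness for the Toda field *)

Section Lipschitz.
Variables (R : realType) (n : nat).
Implicit Types A B M : 'M[R]_n.+1.

Definition entries_le A (c : R) := forall i j, `|A i j| <= c.

Lemma entries_le_ge0 A c : entries_le A c -> 0 <= c.
Proof. by move=> /(_ 0 0); apply: le_trans. Qed.

Lemma entries_leW A c d : c <= d -> entries_le A c -> entries_le A d.
Proof. by move=> cd Ac i j; apply: le_trans cd. Qed.

Lemma entries_leD A B c d : entries_le A c -> entries_le B d ->
  entries_le (A + B) (c + d).
Proof. by move=> Ac Bd i j; rewrite mxE (le_trans (ler_normD _ _)) // lerD. Qed.

Lemma entries_leN A c : entries_le A c -> entries_le (- A) c.
Proof. by move=> Ac i j; rewrite mxE normrN. Qed.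

Lemma entries_leM A B c d : entries_le A c -> entries_le B d ->
  entries_le (A *m B) (n.+1%:R * (c * d)).
Proof.
move=> Ac Bd i j; rewrite mxE (le_trans (ler_norm_sum _ _ _)) //.
rewrite -[X in X%:R](card_ord n.+1) mulr_natl -sumr_const ler_sum // => k _.
by rewrite normrM ler_pM.
Qed.

Lemma entries_le_proj A c : entries_le A c -> entries_le (proj_skew A) (c + c).
Proof.
move=> Ac; apply: entries_leD; last apply: entries_leN.
  by move=> i j; rewrite mxE; case: ifP => // _;
    rewrite normr0 (entries_le_ge0 Ac).
by move=> i j; rewrite !mxE; case: ifP => // _;
  rewrite normr0 (entries_le_ge0 Ac).
Qed.

(** Boundedness and the Lipschitz property on each ball of the maximum norm, with one constant for
    both. They are joined because the Lipschitz constant of a product involves bounds on the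
    factors. *)
Definition bounded_lipschitz (f : 'M[R]_n.+1 -> 'M[R]_n.+1) :=
  forall K, exists C, forall A B d,
  entries_le A K -> entries_le B K -> entries_le (A - B) d ->
  entries_le (f A) C /\ entries_le (f A - f B) (C * d).

Lemma bounded_lipschitz_id : bounded_lipschitz id.
Proof.
(* The constant must dominate both the bound [K] and the Lipschitz constant 1. *)
move=> K; exists (1 + K) => A B d AK BK ABd.
have K0 := entries_le_ge0 AK; have d0 := entries_le_ge0 ABd; split.
  by apply: entries_leW AK; rewrite lerDr.
by apply: entries_leW ABd; rewrite ler_peMl // lerDl.
Qed.

Lemma bounded_lipschitz_cst M : bounded_lipschitz (fun=> M).
Proof.
move=> K; exists (\sum_i \sum_j `|M i j|) => A B d AK BK ABd.
have s0 : 0 <= \sum_i \sum_j `|M i j|.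
  by apply: sumr_ge0 => i _; apply: sumr_ge0.
split=> i j; last first.
  by rewrite subrr mxE normr0 mulr_ge0 // (entries_le_ge0 ABd).
rewrite (bigD1 i) //= (bigD1 j) //= -addrA lerDl addr_ge0 ?sumr_ge0 //.
by move=> k _; apply: sumr_ge0.
Qed.

Lemma bounded_lipschitzD f g : bounded_lipschitz f -> bounded_lipschitz g ->
  bounded_lipschitz (fun A => f A + g A).
Proof.
move=> fl gl K; have [C hC] := fl K; have [D hD] := gl K.
exists (C + D) => A B d AK BK ABd.
have [fA fAB] := hC _ _ _ AK BK ABd; have [gA gAB] := hD _ _ _ AK BK ABd.
split; first exact: entries_leD.
by rewrite opprD addrACA mulrDl; apply: entries_leD.
Qed.

Lemma bounded_lipschitzN f : bounded_lipschitz f ->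
  bounded_lipschitz (fun A => - f A).
Proof.
move=> fl K; have [C hC] := fl K; exists C => A B d AK BK ABd.
have [fA fAB] := hC _ _ _ AK BK ABd.
by split; [apply: entries_leN|rewrite -opprD; apply: entries_leN].
Qed.

Lemma bounded_lipschitzM f g : bounded_lipschitz f -> bounded_lipschitz g ->
  bounded_lipschitz (fun A => f A *m g A).
Proof.
move=> fl gl K; have [C hC] := fl K; have [D hD] := gl K.
exists (n.+1%:R * (C * D) + n.+1%:R * (C * D)) => A B d AK BK ABd.
have [fA fAB] := hC _ _ _ AK BK ABd; have [gA gAB] := hD _ _ _ AK BK ABd.
(* Comparing [B] with itself serves only to extract the bound on [f B]. *)
have BB : entries_le (B - B) d.
  by move=> i j; rewrite subrr mxE normr0 (entries_le_ge0 ABd).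
have [fB _] := hC _ _ _ BK BK BB.
have [C0 D0] := (entries_le_ge0 fA, entries_le_ge0 gA); split.
  by apply: entries_leW (entries_leM fA gA); rewrite lerDl !mulr_ge0.
have -> : f A *m g A - f B *m g B = (f A - f B) *m g A + f B *m (g A - g B).
  by rewrite mulmxBl mulmxBr addrA subrK.
rewrite mulrDl; apply: entries_leD.
  have -> : n.+1%:R * (C * D) * d = n.+1%:R * (C * d * D) by ring.
  exact: entries_leM.
have -> : n.+1%:R * (C * D) * d = n.+1%:R * (C * (D * d)) by ring.
exact: entries_leM.
Qed.

Lemma bounded_lipschitz_proj f : bounded_lipschitz f ->
  bounded_lipschitz (fun A => proj_skew (f A)).
Proof.
move=> fl K; have [C hC] := fl K; exists (C + C) => A B d AK BK ABd.
have [fA fAB] := hC _ _ _ AK BK ABd; split; first exact: entries_le_proj.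
have -> : proj_skew (f A) - proj_skew (f B) = proj_skew (f A - f B).
  apply/matrixP => i j; rewrite !mxE.
  by case: ifP => _; case: ifP => _; ring.
by rewrite mulrDl; apply: entries_le_proj.
Qed.

Lemma bounded_lipschitz_horner (p : {poly R}) :
  bounded_lipschitz (fun A => horner_mx A p).
Proof.
elim/poly_ind: p => [|p c IH].
  have -> : (fun A => horner_mx A 0) = fun=> (0 : 'M[R]_n.+1).
    by apply/funext => A; rewrite rmorph0.
  exact: bounded_lipschitz_cst.
have -> : (fun A : 'M[R]_n.+1 => horner_mx A (p * 'X + c%:P)) =
    fun A => horner_mx A p *m A + c%:M.
  by apply/funext => A; rewrite rmorphD rmorphM /= horner_mx_X horner_mx_C.
apply: bounded_lipschitzD (bounded_lipschitz_cst _).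
exact: bounded_lipschitzM bounded_lipschitz_id.
Qed.

Lemma bounded_lipschitz_toda (p : {poly R}) :
  bounded_lipschitz (fun A => lie_bracket A (proj_skew (horner_mx A p))).
Proof.
have h := bounded_lipschitz_proj (bounded_lipschitz_horner p).
apply: bounded_lipschitzD; last apply: bounded_lipschitzN.
  exact: bounded_lipschitzM bounded_lipschitz_id h.
exact: bounded_lipschitzM h bounded_lipschitz_id.
Qed.

(** The squared Frobenius norm is the quantity for the Gronwall argument, since the maximum norm is
    not differentiable. *)
Lemma is_derive_sum_sqr (M : R -> 'M[R]_n.+1) dM (t : R) : is_derive t 1 M dM ->
  is_derive t 1 (fun x => \sum_i \sum_j M x i j ^+ 2)
    (\sum_i \sum_j 2 * (M t i j * dM i j)).
Proof.
move=> /is_derive_mxP d; do 2!apply: is_derive_bigsum => ?.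
apply: is_derive_eq (is_deriveM (d _ _) (d _ _)) _.
by rewrite /GRing.scale /=; ring.
Qed.

Lemma sum_sqr_le (M : 'M[R]_n.+1) i j :
  M i j ^+ 2 <= \sum_k \sum_l M k l ^+ 2.
Proof.
rewrite (bigD1 i) //= (bigD1 j) //= -addrA lerDl addr_ge0 ?sumr_ge0 // => *.
  by rewrite sqr_ge0.
by apply: sumr_ge0 => *; rewrite sqr_ge0.
Qed.

Lemma sum_sqr_entries_le (M : 'M[R]_n.+1) :
  entries_le M (Num.sqrt (\sum_i \sum_j M i j ^+ 2)).
Proof.
move=> i j; rewrite -sqrtr_sqr ler_sqrt ?sum_sqr_le //.
by do 2!apply: sumr_ge0 => ? _; rewrite sqr_ge0.
Qed.

Lemma solution_bounded (M dM : R -> 'M[R]_n.+1) (a b : R) : a <= b ->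
  (forall x, x \in `[a, b]%R -> is_derive x 1 M (dM x)) ->
  exists K, forall x, x \in `[a, b]%R -> entries_le (M x) K.
Proof.
move=> ab dM_.
have [|c _ hc] := @EVT_max R (fun x => \sum_i \sum_j M x i j ^+ 2) a b ab.
  apply: derivable_within_continuous => x /dM_ d.
  by case: (is_derive_sum_sqr d).
exists (Num.sqrt (\sum_i \sum_j M c i j ^+ 2)) => x xab.
by apply: entries_leW (sum_sqr_entries_le _); rewrite ler_wsqrtr // hc.
Qed.

Lemma autonomous_unique_segment f (M N : R -> 'M[R]_n.+1) (a b : R) : a <= b ->
  bounded_lipschitz f ->
  (forall x, x \in `[a, b]%R -> is_derive x 1 M (f (M x))) ->
  (forall x, x \in `[a, b]%R -> is_derive x 1 N (f (N x))) ->
  (M a = N a -> M b = N b) /\ (M b = N b -> M a = N a).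
Proof.
move=> ab fl dM dN.
have [K1 MK] := solution_bounded ab dM; have [K2 NK] := solution_bounded ab dN.
(* One ball containing both solutions on the whole segment. *)
have [C hC] := fl (Num.max K1 K2).
pose e x := \sum_i \sum_j (M x - N x) i j ^+ 2.
have eP x : (e x = 0) <-> (M x = N x).
  split=> [ex|ex]; last first.
    by rewrite /e ex; do 2!(rewrite big1 // => ? _); rewrite subrr mxE expr0n.
  apply/eqP; rewrite -subr_eq0; apply/eqP/matrixP => i j; rewrite [RHS]mxE.
  have := sum_sqr_le (M x - N x) i j; rewrite -/(e x) ex => h.
  by apply/eqP; rewrite -sqrf_eq0 eq_le h sqr_ge0.
have e0 x : 0 <= e x by do 2!apply: sumr_ge0 => ? _; rewrite sqr_ge0.
pose de x := \sum_i \sum_j 2 * ((M x - N x) i j * (f (M x) - f (N x)) i j).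
(* Entries of [M - N] are at most the square root of [e], those of [f M - f N] at most [C] times it,
   so each summand of [de] is at most [2 * C * e]. *)
pose L : R := \sum_(i < n.+1) \sum_(j < n.+1) 2 * C.
have [] := @gronwall_eq0 _ e de a b L ab.
- move=> x xab; apply: is_derive_sum_sqr.
  by have := is_deriveB (dM x xab) (dN x xab).
- by [].
- move=> x xab.
  have d1 := sum_sqr_entries_le (M x - N x).
  have MKx : entries_le (M x) (Num.max K1 K2).
    by apply: entries_leW (MK x xab); rewrite le_max lexx.
  have NKx : entries_le (N x) (Num.max K1 K2).
    by apply: entries_leW (NK x xab); rewrite le_max lexx orbT.
  have [_ d2] := hC _ _ _ MKx NKx d1.
  rewrite /de (le_trans (ler_norm_sum _ _ _)) // /L mulr_suml ler_sum // => i _.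
  rewrite (le_trans (ler_norm_sum _ _ _)) // mulr_suml ler_sum // => j _.
  rewrite !normrM ger0_norm // -mulrA ler_wpM2l //.
  apply: le_trans (ler_pM _ _ (d1 i j) (d2 i j)) _ => //.
  by rewrite mulrCA -expr2 sqr_sqrtr ?lexx //; apply: e0.
by move=> h1 h2; split=> /eP ?; apply/eP; [apply: h1|apply: h2].
Qed.

Lemma toda_unique (p : {poly R}) (I : set R) (M N : R -> 'M[R]_n.+1) (t0 : R) :
  open_interval I -> toda_solution p I M -> toda_solution p I N ->
  I t0 -> M t0 = N t0 -> forall t, I t -> M t = N t.
Proof.
move=> [_ iI] sM sN It0 e0 t It.
have sub a b : I a -> I b -> forall x, x \in `[a, b]%R -> I x.
  by move=> Ia Ib x; rewrite in_itv /=; apply: iI.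
have [t0t|/ltW tt0] := leP t0 t.
  have [+ _] := autonomous_unique_segment t0t (bounded_lipschitz_toda p)
    (fun x xI => sM x (sub _ _ It0 It x xI))
    (fun x xI => sN x (sub _ _ It0 It x xI)).
  exact.
have [_] := autonomous_unique_segment tt0 (bounded_lipschitz_toda p)
    (fun x xI => sM x (sub _ _ It It0 x xI))
    (fun x xI => sN x (sub _ _ It It0 x xI)).
exact.
Qed.

(** The equation is autonomous; translation in time makes the explicit solution, which starts at 0,
    start at any prescribed time. *)
Lemma toda_solution_shift (p : {poly R}) (M : R -> 'M[R]_n.+1) (I : set R)
    (s : R) :
  toda_solution p setT M -> toda_solution p I (fun t => M (t - s)).
Proof.
move=> sM t _; apply/is_derive_mxP => i j.
have /is_derive_mxP/(_ i j) d := sM (t - s) Logic.I.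
have ds : is_derive t 1 (fun x : R => x - s) 1.
  have d1 := is_deriveB (is_derive_id t 1) (is_derive_cst s t 1).
  by apply: is_derive_eq d1 _; rewrite subr0.
have := @is_derive1_comp _ (fun x => M x i j) (fun x => x - s) t _ _ d ds.
by rewrite mulr1.
Qed.

End Lipschitz.

(** * The linear evolution of [Z], and the theorem *)

Section LinearizedFlow.
Variables (R : realType) (n : nat).

Lemma UGL_toda_flow (e : 'rV[R]_n.+1) X p t : GLpos X ->
  UGL (diag_mx e) (toda_flow e X p t).
Proof.
move=> gX; have [uX _] := gX; rewrite toda_flowE //; apply: UGL_conj_upper.
  exact: toda_R_Uppos.
by exists X.
Qed.

Definition linear_flow (e : 'rV[R]_n.+1) (p : {poly R}) (Z : 'M[R]_n.+1) t :=
  diag_mx (exp_row e p t) *m Z *m invmx (diag_mx (exp_row e p t)).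

(** Conjugation by a diagonal matrix scales each entry separately, which reduces the equation for
    [Z] to scalar exponentials. *)
Lemma linear_flowE e p Z t i j : linear_flow e p Z t i j =
  Z i j * expR (t * (p.[e 0 i] - p.[e 0 j])).
Proof.
have DD : diag_mx (exp_row e p t) *m diag_mx (exp_row e p (- t)) = 1%:M.
  rewrite mulmx_diag; apply/matrixP => k l.
  by rewrite !mxE -expRD mulNr subrr expR0.
have [uD _] := mulmx1_unit DD.
rewrite /linear_flow.
have -> : invmx (diag_mx (exp_row e p t)) = diag_mx (exp_row e p (- t)).
  by rewrite -[RHS](mulKmx uD) DD mulmx1.
rewrite mul_mx_diag mul_diag_mx !mxE mulrAC -expRD mulrC.
by congr (_ * expR _); ring.
Qed.

Lemma is_derive_linear_flow e p Z (t t0 : R) :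
  is_derive t 1 (fun x => linear_flow e p Z (x - t0))
    (lie_bracket (linear_flow e p Z (t - t0)) (- horner_mx (diag_mx e) p)).
Proof.
apply/is_derive_mxP => i j; under eq_fun do rewrite linear_flowE.
set k := p.[e 0 i] - p.[e 0 j].
have dk : is_derive t 1 (fun x : R => (x - t0) * k) k.
  have ds := is_deriveB (is_derive_id t 1) (is_derive_cst t0 t 1).
  apply: is_derive_eq (is_deriveM ds (is_derive_cst k t 1)) _.
  by rewrite /GRing.scale /=; ring.
have dx := @is_derive1_comp _ expR (fun x => (x - t0) * k) t _ _
  (is_derive_expR _) dk.
apply: is_derive_eq (is_deriveM (is_derive_cst (Z i j) t 1) dx) _.
rewrite /lie_bracket mulmxN mulNmx opprK addrC horner_mx_diag.
move: (linear_flowE e p Z (t - t0) i j); move: (linear_flow _ _ _ _) => W.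
rewrite -/k mul_mx_diag mul_diag_mx !mxE => ->.
by rewrite /GRing.scale /= /k; ring.
Qed.

End LinearizedFlow.

Theorem theorem3 (R : realType) (n : nat) (lam : 'I_n.+1 -> R)
    (hlam : strictly_decreasing lam) (s : 'S_n.+1) (p : {poly R}) :
  [/\ (* invariance *)
      forall (I : set R) (M : R -> 'M[R]_n.+1) (t0 : R),
        open_interval I -> toda_solution p I M ->
        I t0 -> UGL (perm_diag lam s) (M t0) ->
        forall t, I t -> UGL (perm_diag lam s) (M t),
      (* the flow in linearizing variables *)
      forall (I : set R) (M : R -> 'M[R]_n.+1),
        open_interval I -> toda_solution p I M ->
        (forall t, I t -> UGL (perm_diag lam s) (M t)) ->
        exists E Y Z : R -> 'M[R]_n.+1,
          (forall t, I t ->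
             unique (linearizing_variables s (M t)) (E t, Y t, Z t) /\
             E t = perm_diag lam s) /\
          (forall t, I t ->
             [/\ is_derive t 1 E 0,
                 is_derive t 1 Y 0 &
                 is_derive t 1 Z
                   (lie_bracket (Z t) (- horner_mx (E t) p))]) &
      (* the maximal solution is global *)
      forall M0 : 'M[R]_n.+1, UGL (perm_diag lam s) M0 ->
        exists M : R -> 'M[R]_n.+1,
          [/\ M 0 = M0,
              toda_solution p setT M,
              forall t, UGL (perm_diag lam s) (M t) &
              forall (I : set R) (N : R -> 'M[R]_n.+1),
                open_interval I -> I 0 -> toda_solution p I N ->
                N 0 = M0 -> forall t, I t -> N t = M t]].
Proof.
(* By uniqueness every solution through the chart is a time translate of the explicit flow; all
   three claims follow from this. *)
have flowP (I : set R) (M : R -> 'M[R]_n.+1) (t0 : R) X :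
    open_interval I -> toda_solution p I M -> I t0 -> GLpos X ->
    M t0 = toda_init (\row_i lam (s i)) X ->
    forall t, I t -> M t = toda_flow (\row_i lam (s i)) X p (t - t0).
  move=> oI sM It0 [uX _] M0.
  apply: (toda_unique oI sM _ It0); last by rewrite subrr toda_flow0.
  exact/toda_solution_shift/toda_flow_solution.
rewrite perm_diagE; set e := \row_i lam (s i) in flowP *; split.
- move=> I M t0 oI sM It0 [X gX M0] t It.
  by rewrite (flowP _ _ _ _ oI sM It0 gX M0) //; apply: UGL_toda_flow.
- move=> I M oI sM uM.
  (* An empty [I] offers no base time, and there any curves will do. Otherwise the variables at [t0]
     determine the curves. *)
  have [[t0 It0]|nI] := pselect (exists t0, I t0); last first.
    exists (cst 0), (cst 0), (cst 0).
    by split=> t It; case: nI; exists t.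
  have [X gX M0] := uM _ It0; have [uX _] := gX.
  have ugl := uM _ It0; rewrite -[diag_mx e]perm_diagE in ugl.
  have [Y [Z lv]] := linearizing_variables_exist hlam ugl.
  exists (cst (diag_mx e)), (cst Y), (fun t => linear_flow e p Z (t - t0)).
  split=> t It; last first.
    split; [exact: is_derive_cst|exact: is_derive_cst|].
    exact: is_derive_linear_flow.
  split=> //.
  suff lvt : linearizing_variables s (M t)
      (diag_mx e, Y, linear_flow e p Z (t - t0)).
    by split=> // v; apply: linearizing_variables_unique.
  rewrite (flowP _ _ _ _ oI sM It0 gX M0) //.
  have d0 i : 0 < exp_row e p (t - t0) 0 i by rewrite mxE expR_gt0.
  have M0E : M t0 = invmx X *m perm_diag lam s *m X by rewrite perm_diagE.
  have := linearizing_variables_flow d0 gX M0E (toda_Q_orth e p uX (t - t0))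
    (toda_R_Uppos e p uX (t - t0)) (toda_QR e p uX (t - t0)) lv.
  by rewrite perm_diagE -/e M0.
move=> M0 [X gX M0E]; have [uX _] := gX.
exists (toda_flow e X p); split.
- by rewrite toda_flow0.
- exact: toda_flow_solution.
- by move=> t; apply: UGL_toda_flow.
move=> I N oI I0 sN N0 t It.
by rewrite (flowP _ _ _ _ oI sN I0 gX) ?subr0 // N0.
Qed.
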